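(* Let $\Phi:\mathbb{R}^n\to\mathbb{R}^m$ be a linear operator, let $\mathcal{J}$ be a partition of $\{1,\dots,n\}$, and for $(b,\mu)\in\mathbb{R}^m\times\mathbb{R}_{++}$ let $$S(b,\mu)=\mathrm{argmin}\left\{\frac{1}{2\mu}\|\Phi x-b\|^2+\|x\|_{1,2}\;\middle|\;x\in\mathbb{R}^n\right\},\qquad \|x\|_{1,2}=\sum_{J\in\mathcal{J}}\|x_J\|.$$ Let $(\bar b,\bar\mu)\in\mathbb{R}^m\times\mathbb{R}_{++}$ and let $\bar x\in S(\bar b,\bar\mu)$. Put $\bar y=-\frac{1}{\bar\mu}\Phi^*(\Phi\bar x-\bar b)$, $\mathcal{K}=\{J\in\mathcal{J}: \|\bar y_J\|=1\}$, $\mathcal{H}=\{J\in\mathcal{J}:\|\bar y_J\|<1\}$ and $$\mathcal{V}=\{w\in\mathbb{R}^n: w_J\in\mathbb{R}\{\bar y_J\}\text{ if }J\in\mathcal{K},\ \text{and } w_J=0\text{ if }J\in\mathcal{H}\}.$$ Then the following are equivalent: (i) $\mathrm{Ker}\,\Phi\cap\mathcal{V}=\{0\}$. (ii) The solution mapping $S$ is single-valued and Lipschitz continuous around $(\bar b,\bar\mu)$ with $S(\bar b,\bar\mu)=\bar x$. (iii) The solution mapping $S$ is single-valued around $(\bar b,\bar\mu)$ with $S(\bar b,\bar\mu)=\bar x$.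
   Context: $\mathbb{R}_{++}=(0,\infty)$. For $J\in\mathcal{J}$, $x_J\in\mathbb{R}^{|J|}$ is the subvector of $x$ with indices in $J$; $\|\cdot\|$ is the Euclidean norm; $\Phi^*$ is the adjoint of $\Phi$; $\mathbb{R}\{\bar y_J\}$ is the line spanned by $\bar y_J$. ''Around $(\bar b,\bar\mu)$'' means on some neighborhood of $(\bar b,\bar\mu)$ in $\mathbb{R}^m\times\mathbb{R}_{++}$. *)

(* Defs.v *)
From HB Require Import structures.
From mathcomp Require Import all_boot all_order all_algebra.
From mathcomp Require Import all_classical all_reals all_analysis.

Set Implicit Arguments.
Unset Strict Implicit.
Unset Printing Implicit Defensive.

Import Order.TTheory GRing.Theory Num.Theory.
Import numFieldNormedType.Exports.

Local Open Scope classical_set_scope.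
Local Open Scope ring_scope.

(* The norm [`|x|] provided by the library on matrices is the sup norm. *)
Definition enorm (R : realType) (n : nat) (x : 'cV[R]_n) : R :=
  Num.sqrt (\sum_(i < n) x i 0 ^+ 2).

Definition subvec (R : realType) (n : nat) (J : {set 'I_n}) (x : 'cV[R]_n)
    : 'cV[R]_#|J| :=
  rowsub (@enum_val _ (mem J)) x.

Definition norm12 (R : realType) (n : nat) (P : {set {set 'I_n}})
    (x : 'cV[R]_n) : R :=
  \sum_(J in P) enorm (subvec J x).

Definition objective (R : realType) (m n : nat) (Phi : 'M[R]_(m, n))
    (P : {set {set 'I_n}}) (b : 'cV[R]_m) (mu : R) (x : 'cV[R]_n) : R :=
  (2 * mu)^-1 * enorm (Phi *m x - b) ^+ 2 + norm12 P x.

Definition argmin (R : realType) (T : Type) (f : T -> R) : set T :=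
  [set x | forall z, f x <= f z].

(* Only meaningful for [0 < p.2], see [dataset]. *)
Definition Sol (R : realType) (m n : nat) (Phi : 'M[R]_(m, n))
    (P : {set {set 'I_n}}) (p : 'cV[R]_m * R) : set 'cV[R]_n :=
  argmin (objective Phi P p.1 p.2).

Definition dataset (R : realType) (m : nat) : set ('cV[R]_m * R) :=
  [set p | 0 < p.2].

(* As [dataset] is open, the neighborhoods of one of its points in the
   subspace [dataset] are the neighborhoods of that point in the whole space
   that are included in [dataset]. *)
Definition single_valued_around (R : realType) (m n : nat)
    (S : 'cV[R]_m * R -> set 'cV[R]_n) (p0 : 'cV[R]_m * R) : Prop :=
  exists U : set ('cV[R]_m * R),
    [/\ nbhs p0 U, U `<=` @dataset R m
      & forall p, U p -> exists x, S p = [set x]].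

Definition edist (R : realType) (m : nat) (p q : 'cV[R]_m * R) : R :=
  Num.sqrt (enorm (p.1 - q.1) ^+ 2 + (p.2 - q.2) ^+ 2).

Definition single_valued_lipschitz_around (R : realType) (m n : nat)
    (S : 'cV[R]_m * R -> set 'cV[R]_n) (p0 : 'cV[R]_m * R) : Prop :=
  exists (U : set ('cV[R]_m * R)) (s : 'cV[R]_m * R -> 'cV[R]_n) (L : R),
    [/\ nbhs p0 U, U `<=` @dataset R m,
        forall p, U p -> S p = [set s p]
      & forall p q, U p -> U q -> enorm (s p - s q) <= L * edist p q].

Definition dual_vec (R : realType) (m n : nat) (Phi : 'M[R]_(m, n))
    (b : 'cV[R]_m) (mu : R) (x : 'cV[R]_n) : 'cV[R]_n :=
  - (mu^-1 *: (Phi^T *m (Phi *m x - b))).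

Definition Kset (R : realType) (n : nat) (P : {set {set 'I_n}})
    (y : 'cV[R]_n) : {set {set 'I_n}} :=
  [set J in P | enorm (subvec J y) == 1]%SET.

Definition Hset (R : realType) (n : nat) (P : {set {set 'I_n}})
    (y : 'cV[R]_n) : {set {set 'I_n}} :=
  [set J in P | enorm (subvec J y) < 1]%SET.

Definition Vspace (R : realType) (n : nat) (P : {set {set 'I_n}})
    (y : 'cV[R]_n) : set 'cV[R]_n :=
  [set w | (forall J, J \in Kset P y ->
              exists t : R, subvec J w = t *: subvec J y) /\
           (forall J, J \in Hset P y -> subvec J w = 0)].

Definition Ker (R : realType) (m n : nat) (Phi : 'M[R]_(m, n))
    : set 'cV[R]_n :=
  [set x | Phi *m x = 0].

(* Main.v *)
Require Import Defs.
From HB Require Import structures.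
From mathcomp Require Import all_boot all_order all_algebra.
From mathcomp Require Import all_classical all_reals all_analysis.
From mathcomp Require Import ring lra.

Set Implicit Arguments.
Unset Strict Implicit.
Unset Printing Implicit Defensive.

Import Order.TTheory GRing.Theory Num.Theory.
Import numFieldNormedType.Exports.

Local Open Scope classical_set_scope.
Local Open Scope ring_scope.

(** The optimality condition for [x] at the data [(b, mu)] is blockwise: the
dual vector [y = dual_vec Phi b mu x] has blocks of norm at most 1 and
[dot y_J x_J = enorm x_J] ([SolP]). Hence every block of a solution is
[x_J = enorm x_J *: y_J], and only the blocks with [enorm y_J = 1] can be
active.

Uniqueness near the data forces injectivity on [Vspace P ybar]
([single_valued_around_injective]): moving [xbar] slightly along [ybar] on all
the blocks of [Kset P ybar], and moving [bbar] by the image of that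
displacement, keeps the residual, hence [ybar], and makes all those blocks
nonzero. From such a point any small step in the kernel of [Phi] inside
[Vspace P ybar] only rescales active blocks, so it leads to another solution
for the same data.

Conversely, let [x] and [z] be solutions for nearby data, with dual vectors [y]
and [v]. Blockwise,
  [x_J - z_J = g_J *: ybar_J + g_J *: (y_J - ybar_J) + enorm z_J *: (y_J - v_J)]
with [g_J = enorm x_J - enorm z_J]. The first term lies in [Vspace P ybar],
where [Phi] is bounded below. The second one is at most a small multiple of
[x - z], once [y] is close to [ybar]. The third one is controlled by the
curvature of the Euclidean norm: its square is at most a multiple of
[dot (y - v) (x - z)] ([certificate_curvature]). So [enorm (x - z) ^+ 2] is at
most a multiple of
  [dot (y - v) (x - z) + mu^-1 * enorm (Phi *m (x - z)) ^+ 2],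
and this sum equals the inner product of [Phi *m (x - z)] with a vector that is
Lipschitz in the data ([dual_vec_monotone], [data_shift_le]). Dividing by
[enorm (x - z)] gives the Lipschitz bound, which contains uniqueness. The same
monotonicity identity shows that the dual vector depends continuously on the data ([Sol_dual_vec_le]), which is what keeps [y]
and [v] close to [ybar]. Existence is coercivity and compactness
([Sol_exists]). *)

(** * Euclidean inner product *)

Definition dot (R : realType) (n : nat) (x y : 'cV[R]_n) : R :=
  \sum_(i < n) x i 0 * y i 0.

Lemma dotC (R : realType) n (x y : 'cV[R]_n) : dot x y = dot y x.
Proof. by apply: eq_bigr => i _; rewrite mulrC. Qed.

Lemma dotDl (R : realType) n (x y z : 'cV[R]_n) :
  dot (x + y) z = dot x z + dot y z.
Proof. by rewrite -big_split; apply: eq_bigr => i _; rewrite mxE mulrDl. Qed.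

Lemma dotZl (R : realType) n a (x z : 'cV[R]_n) : dot (a *: x) z = a * dot x z.
Proof. by rewrite mulr_sumr; apply: eq_bigr => i _; rewrite mxE mulrA. Qed.

Lemma dotNl (R : realType) n (x z : 'cV[R]_n) : dot (- x) z = - dot x z.
Proof. by rewrite -scaleN1r dotZl mulN1r. Qed.

Lemma dotDr (R : realType) n (x y z : 'cV[R]_n) :
  dot z (x + y) = dot z x + dot z y.
Proof. by rewrite !(dotC z) dotDl. Qed.

Lemma dotZr (R : realType) n a (x z : 'cV[R]_n) : dot z (a *: x) = a * dot z x.
Proof. by rewrite !(dotC z) dotZl. Qed.

Lemma dotNr (R : realType) n (x z : 'cV[R]_n) : dot z (- x) = - dot z x.
Proof. by rewrite !(dotC z) dotNl. Qed.

Definition dot_linear := (dotDl, dotDr, dotZl, dotZr, dotNl, dotNr).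

Lemma dot_mulmx (R : realType) m n (A : 'M[R]_(m, n)) (x : 'cV[R]_n)
    (y : 'cV[R]_m) : dot y (A *m x) = dot (A^T *m y) x.
Proof.
have dotE k (u v : 'cV[R]_k) : dot u v = (u^T *m v) 0 0.
  by rewrite mxE; apply: eq_bigr => i _; rewrite mxE.
by rewrite !dotE trmx_mul trmxK mulmxA.
Qed.

Lemma enorm_ge0 (R : realType) n (x : 'cV[R]_n) : 0 <= enorm x.
Proof. exact: sqrtr_ge0. Qed.

Lemma enorm_sqr (R : realType) n (x : 'cV[R]_n) : enorm x ^+ 2 = dot x x.
Proof.
by rewrite sqr_sqrtr ?sumr_ge0 // => i _; rewrite sqr_ge0.
Qed.

Lemma enorm_sqrD (R : realType) n (x y : 'cV[R]_n) :
  enorm (x + y) ^+ 2 = enorm x ^+ 2 + 2 * dot x y + enorm y ^+ 2.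
Proof. by rewrite !enorm_sqr !dot_linear (dotC y x); ring. Qed.

Lemma enormZ (R : realType) n a (x : 'cV[R]_n) :
  enorm (a *: x) = `|a| * enorm x.
Proof.
apply/eqP; rewrite -(eqrXn2 (n := 2)) ?mulr_ge0 ?enorm_ge0 //.
rewrite exprMn !enorm_sqr dotZl dotZr real_normK ?num_real //.
by apply/eqP; ring.
Qed.

Lemma enormN (R : realType) n (x : 'cV[R]_n) : enorm (- x) = enorm x.
Proof. by rewrite -scaleN1r enormZ normrN1 mul1r. Qed.

Lemma enorm0 (R : realType) n : enorm (0 : 'cV[R]_n) = 0.
Proof. by rewrite -(scale0r 0) enormZ normr0 mul0r. Qed.

Lemma enorm_distC (R : realType) n (x y : 'cV[R]_n) :
  enorm (x - y) = enorm (y - x).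
Proof. by rewrite -opprB enormN. Qed.

Lemma le_coord_enorm (R : realType) n (x : 'cV[R]_n) i :
  `|x i 0| <= enorm x.
Proof.
rewrite -ler_sqr ?nnegrE ?enorm_ge0 // enorm_sqr real_normK ?num_real //.
rewrite /dot (bigD1 i) //= -expr2 lerDl sumr_ge0 // => j _.
by rewrite -expr2 sqr_ge0.
Qed.

Lemma enorm_eq0 (R : realType) n (x : 'cV[R]_n) : enorm x <= 0 -> x = 0.
Proof.
move=> x0; apply/matrixP => i j; rewrite ord1 [RHS]mxE; apply/eqP.
by rewrite -normr_le0 (le_trans (le_coord_enorm _ _)).
Qed.

Lemma dot_le (R : realType) n (x y : 'cV[R]_n) :
  dot x y <= enorm x * enorm y.
Proof.
have [/enorm_eq0 ->|x0] := leP (enorm x) 0.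
  by rewrite -(scale0r 0) dotZl mul0r mulr_ge0 ?enorm_ge0.
have [/enorm_eq0 ->|y0] := leP (enorm y) 0.
  by rewrite -(scale0r 0) dotZr mul0r mulr_ge0 ?enorm_ge0.
have xy0 : 0 < enorm x * enorm y by rewrite mulr_gt0.
rewrite -(ler_pM2l xy0).
have := sqr_ge0 (enorm (enorm y *: x - enorm x *: y)).
rewrite enorm_sqr !dot_linear (dotC y x) -!enorm_sqr.
by set a := enorm x; set b := enorm y; set c := dot x y; nra.
Qed.

Lemma ler_enormD (R : realType) n (x y : 'cV[R]_n) :
  enorm (x + y) <= enorm x + enorm y.
Proof.
rewrite -ler_sqr ?nnegrE ?addr_ge0 ?enorm_ge0 // enorm_sqrD.
have := dot_le x y; nra.
Qed.

(** Only the existence of an operator bound matters, so the Frobenius-like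
bound obtained row by row is enough. *)
Lemma mulmx_enorm_bound (R : realType) m n (A : 'M[R]_(m, n)) :
  exists2 C : R, 0 <= C & forall x, enorm (A *m x) <= C * enorm x.
Proof.
pose C := \sum_(i < m) enorm (row i A)^T.
have C0 : 0 <= C by rewrite sumr_ge0 // => i _; rewrite enorm_ge0.
exists C => // x; have x0 := enorm_ge0 x.
rewrite -ler_sqr ?nnegrE ?mulr_ge0 ?enorm_ge0 // exprMn enorm_sqr.
have rowb i : `|(A *m x) i 0| <= enorm (row i A)^T * enorm x.
  have -> : (A *m x) i 0 = dot (row i A)^T x.
    by rewrite mxE; apply: eq_bigr => j _; rewrite !mxE.
  rewrite ler_norml dot_le andbT lerNl -dotNl -(enormN (row i A)^T).
  exact: dot_le.
apply: (@le_trans _ _ (\sum_i enorm (row i A)^T * C * enorm x ^+ 2)).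
  apply: ler_sum => i _; rewrite -expr2 -(@real_normK _ ((A *m x) i 0)) ?num_real //.
  have r0 := enorm_ge0 (row i A)^T.
  have rC : enorm (row i A)^T <= C.
    rewrite /C (bigD1 i) //= lerDl sumr_ge0 // => j _; exact: enorm_ge0.
  apply: (@le_trans _ _ ((enorm (row i A)^T * enorm x) ^+ 2)).
    by rewrite ler_sqr ?nnegrE ?mulr_ge0.
  by rewrite exprMn ler_wpM2r ?sqr_ge0 // expr2 ler_wpM2l.
by rewrite -!mulr_suml expr2.
Qed.

(** * Blocks of a partition *)

Lemma subvecD (R : realType) n (J : {set 'I_n}) (x y : 'cV[R]_n) :
  subvec J (x + y) = subvec J x + subvec J y.
Proof. by apply/matrixP => i j; rewrite !mxE. Qed.

Lemma subvecZ (R : realType) n (J : {set 'I_n}) a (x : 'cV[R]_n) :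
  subvec J (a *: x) = a *: subvec J x.
Proof. by apply/matrixP => i j; rewrite !mxE. Qed.

Lemma subvecN (R : realType) n (J : {set 'I_n}) (x : 'cV[R]_n) :
  subvec J (- x) = - subvec J x.
Proof. by apply/matrixP => i j; rewrite !mxE. Qed.

Lemma subvec0 (R : realType) n (J : {set 'I_n}) :
  subvec J (0 : 'cV[R]_n) = 0.
Proof. by apply/matrixP => i j; rewrite !mxE. Qed.

Definition subvec_linear := (subvecD, subvecZ, subvecN, subvec0).

Lemma subvec_eqP (R : realType) n (J : {set 'I_n}) (x y : 'cV[R]_n) :
  {in J, forall i, x i 0 = y i 0} <-> subvec J x = subvec J y.
Proof.
split=> [xy|xy i iJ].
  by apply/matrixP => i j; rewrite !mxE ord1; apply/xy/enum_valP.
move/matrixP/(_ (enum_rank_in iJ i) 0): xy.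
by rewrite !mxE enum_rankK_in.
Qed.

Lemma dot_subvec (R : realType) n (P : {set {set 'I_n}}) (x y : 'cV[R]_n) :
  finset.partition P [set: 'I_n]%SET ->
  dot x y = \sum_(J in P) dot (subvec J x) (subvec J y).
Proof.
move=> hP; transitivity (\sum_(i in [set: 'I_n]%SET) x i 0 * y i 0).
  by apply: eq_bigl => i; rewrite finset.in_setT.
rewrite (set_partition_big _ hP); apply: eq_bigr => J _.
by rewrite big_enum_val; apply: eq_bigr => i _; rewrite !mxE.
Qed.

Lemma enorm_subvec_sqr (R : realType) n (P : {set {set 'I_n}}) (x : 'cV[R]_n) :
  finset.partition P [set: 'I_n]%SET ->
  enorm x ^+ 2 = \sum_(J in P) enorm (subvec J x) ^+ 2.
Proof.
move=> hP; rewrite enorm_sqr (dot_subvec _ _ hP).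
by apply: eq_bigr => J _; rewrite enorm_sqr.
Qed.

Lemma enorm_subvec_le (R : realType) n (J : {set 'I_n}) (x : 'cV[R]_n) :
  enorm (subvec J x) <= enorm x.
Proof.
rewrite -ler_sqr ?nnegrE ?enorm_ge0 // !enorm_sqr /dot.
rewrite [leRHS](bigID [in J]) /= [in leRHS]big_enum_val /=.
under eq_bigr do rewrite !mxE.
by rewrite lerDl sumr_ge0 // => i _; rewrite -expr2 sqr_ge0.
Qed.

Definition scale_blocks (R : realType) n (P : {set {set 'I_n}})
    (g : {set 'I_n} -> R) (w : 'cV[R]_n) : 'cV[R]_n :=
  \col_i (g (finset.pblock P i) * w i 0).

Lemma subvec_scale_blocks (R : realType) n (P : {set {set 'I_n}}) g
    (w : 'cV[R]_n) (J : {set 'I_n}) :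
  finset.partition P [set: 'I_n]%SET -> J \in P ->
  subvec J (scale_blocks P g w) = g J *: subvec J w.
Proof.
move=> /and3P[_ tiP _] JP; rewrite -subvecZ; apply/subvec_eqP => i iJ.
by rewrite !mxE (finset.def_pblock tiP JP iJ).
Qed.

Lemma eq_subvec (R : realType) n (P : {set {set 'I_n}}) (x y : 'cV[R]_n) :
  finset.partition P [set: 'I_n]%SET ->
  {in P, forall J, subvec J x = subvec J y} -> x = y.
Proof.
move=> /and3P[/eqP cP _ _] xy; apply/matrixP => i j; rewrite ord1.
have icov : i \in finset.cover P by rewrite cP finset.in_setT.
by apply: (proj2 (subvec_eqP _ _ _) (xy _ (finset.pblock_mem icov)));
  rewrite finset.mem_pblock.
Qed.

(** * Optimality conditions *)

Lemma norm12_ge0 (R : realType) n (P : {set {set 'I_n}}) (x : 'cV[R]_n) :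
  0 <= norm12 P x.
Proof. by apply: sumr_ge0 => J _; apply: enorm_ge0. Qed.

Lemma norm12Z (R : realType) n (P : {set {set 'I_n}}) a (x : 'cV[R]_n) :
  norm12 P (a *: x) = `|a| * norm12 P x.
Proof.
by rewrite /norm12 mulr_sumr; apply: eq_bigr => J _; rewrite subvecZ enormZ.
Qed.

Lemma ler_norm12D (R : realType) n (P : {set {set 'I_n}}) (x y : 'cV[R]_n) :
  norm12 P (x + y) <= norm12 P x + norm12 P y.
Proof.
by rewrite -big_split; apply: ler_sum => J _; rewrite subvecD ler_enormD.
Qed.

(** The blockwise form of [y] being a subgradient of the norm [norm12 P]
at [x]. *)
Definition certificate (R : realType) n (P : {set {set 'I_n}})
    (x y : 'cV[R]_n) : Prop :=
  forall J, J \in P ->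
    enorm (subvec J y) <= 1 /\ dot (subvec J y) (subvec J x) = enorm (subvec J x).

Lemma certificateP (R : realType) n (P : {set {set 'I_n}}) (x y : 'cV[R]_n) :
  finset.partition P [set: 'I_n]%SET ->
  certificate P x y <->
  forall z, norm12 P x + dot y (z - x) <= norm12 P z.
Proof.
move=> hP; split=> [c z|sub].
  have -> : norm12 P x = dot y x.
    by rewrite (dot_subvec _ _ hP); apply: eq_bigr => J /c[].
  rewrite dotDr dotNr addrC subrK (dot_subvec _ _ hP).
  apply: ler_sum => J /c[y1 _]; apply: le_trans (dot_le _ _) _.
  by rewrite ler_piMl ?enorm_ge0.
have yx : dot y x = norm12 P x.
  (* [norm12 P] is positively homogeneous: compare with [0] and [2 x]. *)
  have n0 : norm12 P (0 : 'cV[R]_n) = 0 by rewrite -(scale0r 0) norm12Z normr0 mul0r.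
  have := sub 0; have := sub (2 *: x).
  by rewrite n0 sub0r norm12Z normr_nat !dot_linear; lra.
have le_sub z : dot y z <= norm12 P z.
  by have := sub z; rewrite dotDr dotNr yx; lra.
have y1 J : J \in P -> enorm (subvec J y) <= 1.
  (* Test [dot y z <= norm12 P z] on the block [J] of [y] extended by zero. *)
  move=> JP; pose g J' : R := (J' == J)%:R.
  have gJ J' : J' \in P -> subvec J' (scale_blocks P g y) = g J' *: subvec J' y.
    exact: subvec_scale_blocks.
  have := le_sub (scale_blocks P g y).
  rewrite (dot_subvec _ _ hP) /norm12 (bigD1 J) //= [X in _ <= X](bigD1 J) //=.
  rewrite !big1 => [|J' /andP[J'P /negbTE J'J]|J' /andP[J'P /negbTE J'J]].
  - rewrite !addr0 !gJ // /g eqxx !scale1r -enorm_sqr => le2.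
    have := enorm_ge0 (subvec J y); nra.
  - by rewrite gJ // /g J'J scale0r enorm0.
  - by rewrite gJ // /g J'J dotZr mul0r.
(* The blockwise Cauchy-Schwarz gaps are nonnegative and sum to zero. *)
have gap J : J \in P -> 0 <= enorm (subvec J x) - dot (subvec J y) (subvec J x).
  move=> JP; rewrite subr_ge0 (le_trans (dot_le _ _)) // ler_piMl ?enorm_ge0 //.
  exact: y1.
move=> J JP; split; first exact: y1.
have /eqP : \sum_(J in P)
    (enorm (subvec J x) - dot (subvec J y) (subvec J x)) = 0.
  by rewrite big_split /= sumrN -(dot_subvec _ _ hP) yx subrr.
rewrite psumr_eq0 // => /allP/(_ J (mem_index_enum _)).
by rewrite JP /= subr_eq0 => /eqP.
Qed.

(** When [x_J] is nonzero this says that [y_J] is its unit direction. *)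
Lemma certificate_block (R : realType) n (P : {set {set 'I_n}})
    (x y : 'cV[R]_n) J : certificate P x y -> J \in P ->
  subvec J x = enorm (subvec J x) *: subvec J y.
Proof.
move=> c JP; have [y1 yx] := c _ JP; apply/eqP; rewrite -subr_eq0; apply/eqP.
apply: enorm_eq0; set d := subvec J x - _.
have : enorm d ^+ 2 <= 0.
  rewrite enorm_sqr !dot_linear (dotC (subvec J x) (subvec J y)) yx -!enorm_sqr.
  have := enorm_ge0 (subvec J x); have := enorm_ge0 (subvec J y).
  move: y1; set a := enorm (subvec J y); set b := enorm (subvec J x) => *.
  have : 0 <= b ^+ 2 * (1 - a ^+ 2) by rewrite mulr_ge0 ?sqr_ge0 //; nra.
  nra.
have := enorm_ge0 d; nra.
Qed.

Lemma dual_vec_dot (R : realType) m n (Phi : 'M[R]_(m, n)) b mu x h :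
  dot (dual_vec Phi b mu x) h = - (mu^-1 * dot (Phi *m x - b) (Phi *m h)).
Proof. by rewrite /dual_vec dotNl dotZl dot_mulmx. Qed.

Lemma objectiveD (R : realType) m n (Phi : 'M[R]_(m, n)) P b mu x h :
  0 < mu ->
  objective Phi P b mu (x + h) =
  objective Phi P b mu x + (norm12 P (x + h) - norm12 P x
    - dot (dual_vec Phi b mu x) h) + (2 * mu)^-1 * enorm (Phi *m h) ^+ 2.
Proof.
move=> mu0; rewrite /objective mulmxDr addrAC enorm_sqrD dual_vec_dot.
by field; rewrite gt_eqF.
Qed.

Lemma SolP (R : realType) m n (Phi : 'M[R]_(m, n)) P b mu x :
  finset.partition P [set: 'I_n]%SET -> 0 < mu ->
  Sol Phi P (b, mu) x <-> certificate P x (dual_vec Phi b mu x).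
Proof.
move=> hP mu0; rewrite (certificateP _ _ hP) /Sol /argmin /=.
set y := dual_vec _ _ _ _; split=> [opt z|sub z]; last first.
  rewrite -(subrK x z) (addrC (z - x)) objectiveD // -/y.
  have : 0 <= (2 * mu)^-1 * enorm (Phi *m (z - x)) ^+ 2.
    by rewrite mulr_ge0 ?sqr_ge0 // invr_ge0 mulr_ge0 ?ltW.
  have := sub z; rewrite [x + (z - x)]addrC subrK; lra.
(* First-order optimality: along the segment towards [z] the quadratic part
   contributes [t ^+ 2 * q], which cannot compensate a linear decrease. *)
pose q := (2 * mu)^-1 * enorm (Phi *m (z - x)) ^+ 2.
have q0 : 0 <= q by rewrite mulr_ge0 ?sqr_ge0 // invr_ge0 mulr_ge0 ?ltW.
rewrite leNgt -subr_gt0; apply/negP.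
set d := _ + _ - _ => d0.
have dq t : 0 < t -> t <= 1 -> d <= t * q.
  move=> t0 t1; have := opt (x + t *: (z - x)).
  rewrite objectiveD // -/y -scalemxAr enormZ exprMn real_normK ?num_real //.
  rewrite mulrCA -/q dotZr => le1.
  have : norm12 P (x + t *: (z - x)) <= (1 - t) * norm12 P x + t * norm12 P z.
    rewrite (_ : x + _ = (1 - t) *: x + t *: z).
      apply: le_trans (ler_norm12D _ _ _) _.
      by rewrite !norm12Z !ger0_norm ?(ltW t0) ?subr_ge0.
    by rewrite scalerBr scalerBl scale1r addrA addrAC.
  move: d0 q0; rewrite /d => d0 q0 le2; rewrite -(ler_pM2l t0); nra.
have s0 : 0 < d + q + 1 by lra.
have := dq (d / (d + q + 1)).
rewrite divr_gt0 // ler_pdivrMr // mul1r mulrAC ler_pdivlMr //.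
move=> /(_ isT); have -> : d <= d + q + 1 by lra.
move=> /(_ isT); nra.
Qed.

(** * Existence of solutions and a priori bounds *)

Lemma sum_continuous (R : realType) (T : topologicalType) (I : Type) (r : seq I)
    (Q : pred I) (f : I -> T -> R) :
  (forall i, continuous (f i)) -> continuous (fun t => \sum_(i <- r | Q i) f i t).
Proof.
by move=> cf; apply: continuous_big => [|i _]; [exact: add_continuous | exact: cf].
Qed.

Lemma enorm_continuous (R : realType) (T : topologicalType) k
    (g : T -> 'cV[R]_k) :
  (forall i, continuous (fun t => g t i 0)) -> continuous (fun t => enorm (g t)).
Proof.
move=> cg t.
apply: (@continuous_comp _ _ _ (fun t => \sum_(i < k) g t i 0 ^+ 2) Num.sqrt).
  by apply: sum_continuous => i u; apply: cvgM; apply: cg.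
exact: sqrt_continuous.
Qed.

Lemma objective_continuous (R : realType) (T : topologicalType) m n
    (Phi : 'M[R]_(m, n)) (P : {set {set 'I_n}}) b mu (g : T -> 'cV[R]_n) :
  (forall i, continuous (fun t => g t i 0)) ->
  continuous (fun t => objective Phi P b mu (g t)).
Proof.
move=> cg.
have cres : continuous (fun t => enorm (Phi *m g t - b)).
  apply: enorm_continuous => i.
  under eq_fun do rewrite !mxE.
  move=> t; apply: cvgB; last exact: cvg_cst.
  by apply: sum_continuous => j u; apply: cvgM; [exact: cvg_cst | exact: cg].
move=> t; apply: cvgD.
  by apply: cvgM; [exact: cvg_cst | apply: cvgM; exact: cres].
apply: sum_continuous => J; apply: enorm_continuous => i.
by under eq_fun do rewrite mxE; exact: cg.
Qed.

Lemma enorm_subvec_le_norm12 (R : realType) n (P : {set {set 'I_n}})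
    (x : 'cV[R]_n) J : J \in P -> enorm (subvec J x) <= norm12 P x.
Proof.
move=> JP; rewrite /norm12 (bigD1 J) //= lerDl sumr_ge0 // => ? _.
exact: enorm_ge0.
Qed.

Lemma le_coord_norm12 (R : realType) n (P : {set {set 'I_n}}) (x : 'cV[R]_n) i :
  finset.partition P [set: 'I_n]%SET -> `|x i 0| <= norm12 P x.
Proof.
move=> /and3P[/eqP cP _ _].
have icov : i \in finset.cover P by rewrite cP finset.in_setT.
apply: le_trans (enorm_subvec_le_norm12 x (finset.pblock_mem icov)).
have iJ : i \in finset.pblock P i by rewrite finset.mem_pblock.
have := le_coord_enorm (subvec (finset.pblock P i) x) (enum_rank_in iJ i).
by rewrite !mxE enum_rankK_in.
Qed.

Lemma norm12_le_objective (R : realType) m n (Phi : 'M[R]_(m, n)) P b mu x :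
  0 < mu -> norm12 P x <= objective Phi P b mu x.
Proof.
by move=> mu0; rewrite lerDr mulr_ge0 ?sqr_ge0 // invr_ge0 mulr_ge0 ?ltW.
Qed.

(** The objective is continuous, and outside a large box it exceeds its value
at the origin, so a minimizer over the box is a global one. *)
Lemma Sol_exists (R : realType) m n (Phi : 'M[R]_(m, n)) P b mu :
  finset.partition P [set: 'I_n]%SET -> 0 < mu ->
  exists x, Sol Phi P (b, mu) x.
Proof.
move=> hP mu0; pose M := objective Phi P b mu 0.
have M0 : 0 <= M := le_trans (norm12_ge0 P 0) (norm12_le_objective Phi P b 0 mu0).
pose B := [set v : 'rV[R]_n | forall i, `[- M, M]%classic (v ord0 i)].
have B0 : B 0 by move=> i; rewrite mxE /= in_itv /= oppr_cp0 M0.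
have cB : compact B.
  apply: (@rV_compact _ _ (fun=> `[- M, M]%classic)) => i.
  exact: segment_compact.
have [|v vB vmin] := EVT_min_rV (ex_intro B 0 B0) cB
  (f := fun v => objective Phi P b mu v^T).
  apply: continuous_subspaceT; apply: objective_continuous => i.
  by under eq_fun do rewrite mxE; exact: coord_continuous.
exists v^T => z; have [zB|zB] := pselect (B z^T).
  by have := vmin z^T; rewrite trmxK; apply; rewrite inE.
have [i /negP zi] : exists i, ~ `[- M, M]%classic (z^T ord0 i).
  by apply/not_existsP => H; apply: zB => i; apply: contrapT; exact: H.
have vM := vmin 0; rewrite trmx0 -/M in vM.
apply: le_trans (vM _) _; first by rewrite inE.
apply: le_trans (norm12_le_objective Phi P b z mu0).
apply: le_trans (le_coord_norm12 z i hP).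
by rewrite leNgt; apply: contra zi; rewrite mxE /= in_itv /= -ler_norml => /ltW.
Qed.

Lemma objective0 (R : realType) m n (Phi : 'M[R]_(m, n)) P b mu :
  objective Phi P b mu 0 = (2 * mu)^-1 * enorm b ^+ 2.
Proof.
rewrite /objective mulmx0 sub0r enormN -[X in norm12 _ X](scale0r 0) norm12Z.
by rewrite normr0 mul0r addr0.
Qed.

Lemma Sol_norm12_le (R : realType) m n (Phi : 'M[R]_(m, n)) P b mu x :
  0 < mu -> Sol Phi P (b, mu) x -> norm12 P x <= (2 * mu)^-1 * enorm b ^+ 2.
Proof.
move=> mu0 /(_ 0); rewrite objective0; apply: le_trans.
exact: norm12_le_objective.
Qed.

Lemma Sol_residual_le (R : realType) m n (Phi : 'M[R]_(m, n)) P b mu x :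
  0 < mu -> Sol Phi P (b, mu) x -> enorm (Phi *m x - b) <= enorm b.
Proof.
move=> mu0 /(_ 0); rewrite objective0 => le_obj.
rewrite -ler_sqr ?nnegrE ?enorm_ge0 //.
have i0 : 0 < (2 * mu)^-1 by rewrite invr_gt0 mulr_gt0.
rewrite -(ler_pM2l i0); apply: le_trans le_obj.
by rewrite lerDl norm12_ge0.
Qed.

(** * Uniqueness nearby forces injectivity on the subspace *)

Lemma Vspace_scale_blocks (R : realType) n (P : {set {set 'I_n}})
    (g : {set 'I_n} -> R) (y : 'cV[R]_n) :
  finset.partition P [set: 'I_n]%SET ->
  (forall J, J \in Hset P y -> g J = 0) -> Vspace P y (scale_blocks P g y).
Proof.
move=> hP gH; split=> J JKH; have JP : J \in P by move: JKH; rewrite inE => /andP[].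
  by exists (g J); rewrite subvec_scale_blocks.
by rewrite subvec_scale_blocks // gH // scale0r.
Qed.

Lemma Kset_or_Hset (R : realType) n (P : {set {set 'I_n}}) (x y : 'cV[R]_n) J :
  certificate P x y -> J \in P -> J \in Kset P y \/ J \in Hset P y.
Proof.
move=> c JP; have [yJ _] := c _ JP; rewrite !inE JP /=.
by move: yJ; rewrite le_eqVlt => /orP.
Qed.

(** Moving a solution along this direction makes all the blocks of [Kset P y]
nonzero without changing their directions. *)
Definition activate (R : realType) n (P : {set {set 'I_n}})
    (y : 'cV[R]_n) : 'cV[R]_n :=
  scale_blocks P (fun J => (J \in Kset P y)%:R) y.

(** The multiple of [y] on the blocks of [Kset P y] leaves room for a small
displacement inside [Vspace P y], which changes the block norms but not the
block directions. *)
Lemma certificate_perturb (R : realType) n (P : {set {set 'I_n}})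
    (x y w : 'cV[R]_n) (e : R) :
  finset.partition P [set: 'I_n]%SET -> certificate P x y ->
  Vspace P y w -> enorm w <= e ->
  certificate P (x + e *: activate P y + w) y.
Proof.
move=> hP c [wK wH] we J JP; split; first by case: (c _ JP).
have [JK|JH] := Kset_or_Hset c JP.
  have [t wJ] := wK _ JK.
  have y1 : enorm (subvec J y) = 1 by move: JK; rewrite inE => /andP[_ /eqP].
  have te : `|t| <= e.
    have := le_trans (enorm_subvec_le J w) we.
    by rewrite wJ enormZ y1 mulr1.
  rewrite !subvec_linear subvec_scale_blocks // JK scale1r wJ.
  rewrite (certificate_block c JP) -!scalerDl dotZr -enorm_sqr enormZ y1.
  rewrite ger0_norm ?expr1n //.
  by move: te; rewrite ler_norml => /andP[? _]; have := enorm_ge0 (subvec J x); lra.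
have JnK : J \in Kset P y = false.
  by move: JH; rewrite !inE => /andP[-> /lt_eqF].
rewrite !subvec_linear subvec_scale_blocks // wH // JnK scale0r scaler0 !addr0.
by case: (c _ JP).
Qed.

(** Take [h] equal to [y] on the blocks of [Kset P y] and zero elsewhere. The
points [x + e *: h + u], with [u] small in the kernel and in the subspace, all
solve the problem with data [(b + e *: (Phi *m h), mu)], because the residual
and hence the dual vector are those of [x]. *)
Lemma single_valued_around_injective (R : realType) m n (Phi : 'M[R]_(m, n)) P
    b mu x :
  finset.partition P [set: 'I_n]%SET -> Sol Phi P (b, mu) x ->
  single_valued_around (Sol Phi P) (b, mu) ->
  Ker Phi `&` Vspace P (dual_vec Phi b mu x) = [set 0].
Proof.
move=> hP solx [U [nU Umu Usv]]; set y := dual_vec _ _ _ _.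
have mu0 : 0 < mu by apply: (Umu (b, mu)); exact: nbhs_singleton.
have c : certificate P x y := proj1 (SolP _ _ _ hP mu0) solx.
apply/seteqP; split=> [w [kw vw]|w -> /=]; last first.
  split; first by rewrite /Ker /= mulmx0.
  by split=> J _; rewrite subvec0 //; exists 0; rewrite scale0r.
pose h := activate P y.
pose f (e : R) : 'cV[R]_m * R := (b + e *: (Phi *m h), mu).
have cf : {for 0, continuous f}.
  have cb : (b + t *: (Phi *m h)) @[t --> (0 : R)] --> b + 0 *: (Phi *m h).
    by apply: cvgD; [exact: cvg_cst | apply: cvgZr_tmp; exact: cvg_id].
  exact: (cvg_pair cb (cvg_cst mu)).
have [e e0 Ufe] : exists2 e, 0 < e & U (f e).
  have /nbhs_ballP[r /= r0 rU] : nbhs 0 (f @^-1` U).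
    apply: cf; rewrite /f scale0r addr0. exact nU.
  exists (r / 2); first by rewrite divr_gt0.
  apply: (rU (r / 2)); rewrite /ball /= sub0r normrN gtr0_norm ?divr_gt0 //.
  by rewrite ltr_pdivrMr // ltr_pMr // ltr1n.
have sol u : Ker Phi u -> Vspace P y u -> enorm u <= e ->
    Sol Phi P (f e) (x + e *: h + u).
  move=> ku vu ue; apply/SolP => //.
  suff -> : dual_vec Phi (b + e *: (Phi *m h)) mu (x + e *: h + u) = y.
    exact: certificate_perturb.
  have -> : y = dual_vec Phi b mu x by []; rewrite /dual_vec.
  congr (- (_ *: (_ *m _))).
  by rewrite 2!mulmxDr -scalemxAr (ku : Phi *m u = 0) addr0 opprD addrACA subrr addr0.
have [z Sz] := Usv _ Ufe.
have zE u : Ker Phi u -> Vspace P y u -> enorm u <= e -> x + e *: h + u = z.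
  by move=> ku vu ue; have := sol u ku vu ue; rewrite Sz.
(* The scaling brings [w] within the room [e]. *)
pose s := e / (enorm w + 1).
have w1 : 0 < enorm w + 1 by rewrite ltr_wpDl ?enorm_ge0.
have s0 : 0 < s by rewrite divr_gt0.
have z0 : x + e *: h + 0 = z.
  apply: zE; rewrite ?enorm0 ?(ltW e0) // /Ker /= ?mulmx0 //.
  by split=> J _; rewrite subvec0 //; exists 0; rewrite scale0r.
have zs : x + e *: h + s *: w = z.
  apply: zE; first by rewrite /Ker /= -scalemxAr kw scaler0.
    case: vw => wK wH; split=> J JKH; rewrite subvecZ.
      by have [t ->] := wK _ JKH; exists (s * t); rewrite scalerA.
    by rewrite wH // scaler0.
  rewrite enormZ gtr0_norm // /s mulrAC ler_pdivrMr // ler_wpM2l ?(ltW e0) //.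
  by rewrite lerDl.
have /eqP : s *: w = 0 by apply: (addrI (x + e *: h)); rewrite zs z0.
by rewrite scaler_eq0 gt_eqF //= => /eqP.
Qed.

(** * A lower bound for the operator on the subspace *)

Lemma injective_left_inverse (R : fieldType) m n (A : 'M[R]_(m, n)) :
  (forall x : 'cV[R]_n, A *m x = 0 -> x = 0) -> exists L, L *m A = 1%:M.
Proof.
move=> injA; apply/row_fullP; rewrite /row_full -mxrank_tr -/(row_free A^T).
rewrite -kermx_eq0; apply/eqP/row_matrixP => i; rewrite row0.
apply: trmx_inj; rewrite trmx0; apply: injA.
by rewrite -[X in X *m _]trmxK -trmx_mul -row_mul mulmx_ker row0 trmx0.
Qed.

(** The matrix of the projection onto [Vspace P y] that sends [w] to the
vector with blocks [dot y_J w_J *: y_J] for [J] in [Kset P y]. *)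
Definition Vproj (R : realType) n (P : {set {set 'I_n}}) (y : 'cV[R]_n)
    : 'M[R]_n :=
  \matrix_(i, j) (if (finset.pblock P i \in Kset P y)
                     && (j \in finset.pblock P i)
                  then y i 0 * y j 0 else 0).

Lemma Vproj_mul (R : realType) n (P : {set {set 'I_n}}) (y w : 'cV[R]_n) :
  Vproj P y *m w =
  scale_blocks P (fun J => if J \in Kset P y
                           then dot (subvec J y) (subvec J w) else 0) y.
Proof.
apply/matrixP => i j; rewrite ord1 !mxE; case: ifP => [iK|niK]; last first.
  by rewrite mul0r big1 // => k _; rewrite mxE niK mul0r.
rewrite /dot mulrC mulr_sumr.
under [RHS]eq_bigr do rewrite !mxE.
rewrite -(@big_enum_val _ _ _ _ [in finset.pblock P i]
  (fun k => y i 0 * (y k 0 * w k 0))) /= [RHS]big_mkcond /=.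
by apply: eq_bigr => k _; rewrite mxE iK /=; case: ifP; rewrite ?mul0r ?mulrA.
Qed.

Lemma Vproj_id (R : realType) n (P : {set {set 'I_n}}) (x y w : 'cV[R]_n) :
  finset.partition P [set: 'I_n]%SET -> certificate P x y ->
  Vspace P y w -> Vproj P y *m w = w.
Proof.
move=> hP c [wK wH]; apply: (eq_subvec hP) => J JP.
rewrite Vproj_mul subvec_scale_blocks //.
have [JK|JH] := Kset_or_Hset c JP.
  have [t wJ] := wK _ JK; rewrite JK wJ dotZr -enorm_sqr.
  by move: JK; rewrite inE => /andP[_ /eqP ->]; rewrite expr1n mulr1.
rewrite wH //; case: ifP => [JK|_]; last by rewrite scale0r.
by move: JK JH; rewrite !inE => /andP[_ /eqP ->]; rewrite ltxx andbF.
Qed.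

Lemma Vproj_in (R : realType) n (P : {set {set 'I_n}}) (y w : 'cV[R]_n) :
  finset.partition P [set: 'I_n]%SET -> Vspace P y (Vproj P y *m w).
Proof.
move=> hP; rewrite Vproj_mul; apply: Vspace_scale_blocks => // J.
by case: ifP => // JK; move: JK; rewrite !inE => /andP[_ /eqP ->]; rewrite ltxx andbF.
Qed.

(** The kernel of [col_mx Phi (Vproj P y - 1%:M)] is the intersection of the
kernel of [Phi] with the subspace; a left inverse of that matrix recovers a
vector of the subspace from its image by [Phi]. *)
Lemma injective_on_Vspace_bound (R : realType) m n (Phi : 'M[R]_(m, n)) P
    (x y : 'cV[R]_n) :
  finset.partition P [set: 'I_n]%SET -> certificate P x y ->
  Ker Phi `&` Vspace P y = [set 0] ->
  exists2 k : R, 0 <= k &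
    forall w, Vspace P y w -> enorm w <= k * enorm (Phi *m w).
Proof.
move=> hP c kerV.
have [L LA] : exists L, L *m col_mx Phi (Vproj P y - 1%:M) = 1%:M.
  apply: injective_left_inverse => w; rewrite mul_col_mx => /eqP.
  rewrite col_mx_eq0 mulmxBl mul1mx subr_eq0 => /andP[/eqP kw /eqP pw].
  suff : [set 0] w by [].
  by rewrite -kerV; split=> //; rewrite -pw; apply: Vproj_in.
have [k k0 kL] := mulmx_enorm_bound (lsubmx L).
exists k => // w Vw; rewrite -[X in enorm X <= _](mul1mx w) -LA.
rewrite -[X in X *m col_mx _ _]hsubmxK mul_row_col mulmxDl -mulmxA -[_ *m (_ - _) *m w]mulmxA.
by rewrite mulmxBl mul1mx (Vproj_id hP c Vw) subrr mulmx0 addr0.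
Qed.

(** * Comparing two solutions *)

(** The part of the difference of two dual vectors that comes from the change
of data, up to the transpose of [Phi]: it vanishes when [p = q]. Written so that
its norm is visibly Lipschitz in the data when the residual of [z] is
bounded. *)
Definition data_shift (R : realType) m n (Phi : 'M[R]_(m, n))
    (p q : 'cV[R]_m * R) (z : 'cV[R]_n) : 'cV[R]_m :=
  p.2^-1 *: (p.1 - q.1) + (p.2^-1 - q.2^-1) *: (q.1 - Phi *m z).

Lemma dual_vecB (R : realType) m n (Phi : 'M[R]_(m, n)) p q x z :
  dual_vec Phi p.1 p.2 x - dual_vec Phi q.1 q.2 z =
  Phi^T *m (data_shift Phi p q z - p.2^-1 *: (Phi *m (x - z))).
Proof.
have dualE b mu u : dual_vec Phi b mu u = Phi^T *m (mu^-1 *: (b - Phi *m u)).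
  by rewrite /dual_vec -scalemxAr -scalerN -mulmxN opprB.
rewrite !dualE -mulmxBr /data_shift (mulmxBr Phi); congr (_ *m _).
by apply/matrixP => i j; rewrite !mxE; ring.
Qed.

(** The identity behind all the estimates: for two solutions both terms on the
left are nonnegative, by monotonicity of the subdifferential, while the right
side is small with the change of data. *)
Lemma dual_vec_monotone (R : realType) m n (Phi : 'M[R]_(m, n)) p q x z :
  dot (dual_vec Phi p.1 p.2 x - dual_vec Phi q.1 q.2 z) (x - z)
    + p.2^-1 * enorm (Phi *m (x - z)) ^+ 2
  = dot (data_shift Phi p q z) (Phi *m (x - z)).
Proof.
by rewrite dual_vecB -dot_mulmx; rewrite dot_linear; rewrite enorm_sqr !dot_linear; ring.
Qed.

Lemma edist_fst_le (R : realType) m (p q : 'cV[R]_m * R) :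
  enorm (p.1 - q.1) <= Defs.edist p q.
Proof.
rewrite -ler_sqr ?nnegrE ?enorm_ge0 ?sqrtr_ge0 //.
by rewrite [leRHS]sqr_sqrtr ?addr_ge0 ?sqr_ge0 // lerDl sqr_ge0.
Qed.

Lemma edist_snd_le (R : realType) m (p q : 'cV[R]_m * R) :
  `|p.2 - q.2| <= Defs.edist p q.
Proof.
rewrite -ler_sqr ?nnegrE ?sqrtr_ge0 // real_normK ?num_real //.
by rewrite [leRHS]sqr_sqrtr ?addr_ge0 ?sqr_ge0 // lerDr sqr_ge0.
Qed.

Lemma data_shift_le (R : realType) m n (Phi : 'M[R]_(m, n)) p q z (m0 B : R) :
  0 < m0 -> m0 <= p.2 -> m0 <= q.2 -> enorm (Phi *m z - q.1) <= B ->
  enorm (data_shift Phi p q z) <= (m0^-1 + m0^-1 * m0^-1 * B) * Defs.edist p q.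
Proof.
case: p q => [b mu] [b' nu] /= m00 mmu mnu zB; have mu0 := lt_le_trans m00 mmu.
have nu0 := lt_le_trans m00 mnu.
have /= d1 := edist_fst_le (b, mu) (b', nu).
have /= d2 := edist_snd_le (b, mu) (b', nu).
have d0 : 0 <= Defs.edist (b, mu) (b', nu) := sqrtr_ge0 _.
have imu : mu^-1 <= m0^-1 by rewrite lef_pV2.
have inu : nu^-1 <= m0^-1 by rewrite lef_pV2.
have imu0 : 0 < mu^-1 by rewrite invr_gt0.
have inu0 : 0 < nu^-1 by rewrite invr_gt0.
apply: le_trans (ler_enormD _ _) _; rewrite !enormZ mulrDl.
apply: lerD.
  by rewrite gtr0_norm // ler_pM ?enorm_ge0 // ltW.
have -> : mu^-1 - nu^-1 = mu^-1 * nu^-1 * (nu - mu).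
  by field; rewrite !gt_eqF.
rewrite normrM gtr0_norm ?mulr_gt0 // (distrC nu) enorm_distC -!mulrA.
rewrite [B * _]mulrC.
have r0 := enorm_ge0 (Phi *m z - b').
do 2!(apply: ler_pM => //; rewrite ?mulr_ge0 ?(ltW imu0) ?(ltW inu0) //).
by apply: ler_pM.
Qed.

(** On the unit sphere, moving the direction of a vector costs a quadratic
amount: with [x_J] and [z_J] the multiples of [y_J] and [v_J] by their norms
[a] and [b], the inner product on the right is [(a + b) * (1 - dot y_J v_J)],
and [2 - 2 * dot y_J v_J] bounds the squared distance of [y_J] and [v_J]. *)
Lemma certificate_dist_le (R : realType) n (P : {set {set 'I_n}})
    (x y z v : 'cV[R]_n) J :
  certificate P x y -> certificate P z v -> J \in P ->
  enorm (subvec J (y - v)) ^+ 2 * (enorm (subvec J x) + enorm (subvec J z))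
    <= 2 * dot (subvec J (y - v)) (subvec J (x - z)).
Proof.
move=> cx cz JP; have [y1 yx] := cx _ JP; have [v1 vz] := cz _ JP.
rewrite !subvec_linear enorm_sqr !dot_linear yx vz (dotC (subvec J v) (subvec J y)).
have -> : dot (subvec J y) (subvec J z) =
    enorm (subvec J z) * dot (subvec J y) (subvec J v).
  by rewrite [in LHS](certificate_block cz JP) dotZr.
have -> : dot (subvec J v) (subvec J x) =
    enorm (subvec J x) * dot (subvec J y) (subvec J v).
  by rewrite [in LHS](certificate_block cx JP) dotZr dotC.
rewrite -!enorm_sqr.
have := enorm_ge0 (subvec J x); have := enorm_ge0 (subvec J z).
have := enorm_ge0 (subvec J y); have := enorm_ge0 (subvec J v).
move: y1 v1; set a := enorm (subvec J x); set b := enorm (subvec J z).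
set c := enorm (subvec J y); set d := enorm (subvec J v); set e := dot _ _.
move=> c1 d1 d0 c0 b0 a0.
have c2 : c ^+ 2 <= 1 by rewrite expr_le1.
have d2 : d ^+ 2 <= 1 by rewrite expr_le1.
have : 0 <= (a + b) * (2 - c ^+ 2 - d ^+ 2).
  by apply: mulr_ge0; [exact: addr_ge0 | lra].
nra.
Qed.

Lemma certificate_monotone (R : realType) n (P : {set {set 'I_n}})
    (x y z v : 'cV[R]_n) :
  finset.partition P [set: 'I_n]%SET ->
  certificate P x y -> certificate P z v -> 0 <= dot (y - v) (x - z).
Proof.
move=> hP cx cz; rewrite (dot_subvec _ _ hP) sumr_ge0 // => J JP.
have := certificate_dist_le cx cz JP.
have : 0 <= enorm (subvec J (y - v)) ^+ 2
    * (enorm (subvec J x) + enorm (subvec J z)).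
  by rewrite mulr_ge0 ?sqr_ge0 // addr_ge0 ?enorm_ge0.
lra.
Qed.

(** The gain over [certificate_monotone] that makes a quadratic bound of
[x - z] possible although the norm is not strongly convex: directions vary in
a controlled way, and the weight by [enorm z_J] makes the bound uniform down to
vanishing blocks. *)
Lemma certificate_curvature (R : realType) n (P : {set {set 'I_n}})
    (x y z v : 'cV[R]_n) (M : R) :
  finset.partition P [set: 'I_n]%SET ->
  certificate P x y -> certificate P z v ->
  (forall J, J \in P -> enorm (subvec J z) <= M) ->
  enorm (scale_blocks P (fun J => enorm (subvec J z)) (y - v)) ^+ 2
    <= 2 * M * dot (y - v) (x - z).
Proof.
move=> hP cx cz zM; rewrite (enorm_subvec_sqr _ hP) (dot_subvec _ _ hP) mulr_sumr.
apply: ler_sum => J JP; rewrite subvec_scale_blocks // enormZ exprMn.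
rewrite ger0_norm ?enorm_ge0 //.
have := certificate_dist_le cx cz JP; have := zM _ JP.
have := enorm_ge0 (subvec J z); have := enorm_ge0 (subvec J x).
have := sqr_ge0 (enorm (subvec J (y - v))).
set a := enorm (subvec J x); set b := enorm (subvec J z).
set d := enorm _ ^+ 2; set e := dot _ _ => d0 a0 b0 bM le1.
have da : 0 <= d * a by rewrite mulr_ge0.
have le2 : d * b <= 2 * e by lra.
have : b * (d * b) <= M * (2 * e) by rewrite ler_pM // mulr_ge0.
nra.
Qed.

(** * Stability of the solution *)

(** A block of a solution is the multiple of its dual block by its norm, so
the difference of two solutions is a blockwise multiple of [ybar], plus a term
absorbed by the left-hand side when the dual vectors are close to [ybar], plus
the term bounded in [certificate_curvature]. *)
Lemma certificate_error (R : realType) m n (Phi : 'M[R]_(m, n)) P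
    (ybar x y z v : 'cV[R]_n) (k C e : R) :
  finset.partition P [set: 'I_n]%SET -> 0 <= k -> 0 <= C ->
  (forall w, Vspace P ybar w -> enorm w <= k * enorm (Phi *m w)) ->
  (forall h, enorm (Phi *m h) <= C * enorm h) ->
  (1 + k * C) * e <= 2^-1 ->
  (forall J, J \in Hset P ybar -> enorm (subvec J ybar) + e < 1) ->
  certificate P x y -> certificate P z v ->
  enorm (y - ybar) <= e -> enorm (v - ybar) <= e ->
  enorm (x - z) <= 2 * k * enorm (Phi *m (x - z))
    + 2 * (1 + k * C)
      * enorm (scale_blocks P (fun J => enorm (subvec J z)) (y - v)).
Proof.
move=> hP k0 C0 hk hC kCe He cx cz ye ve.
have inactive (x' y' : 'cV[R]_n) J : certificate P x' y' -> enorm (y' - ybar) <= e ->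
    J \in Hset P ybar -> enorm (subvec J x') = 0.
  move=> c' ye' JH; have JP : J \in P by move: JH; rewrite inE => /andP[].
  have y1 : enorm (subvec J y') < 1.
    rewrite -(subrK ybar y') subvecD; apply: le_lt_trans (ler_enormD _ _) _.
    have := He _ JH; have := le_trans (enorm_subvec_le J (y' - ybar)) ye'; lra.
  have := congr1 (@enorm R _) (certificate_block c' JP).
  rewrite enormZ ger0_norm ?enorm_ge0 // => /eqP.
  rewrite -subr_eq0 -{1}[enorm (subvec J x')]mulr1 -mulrBr mulf_eq0 subr_eq0.
  by rewrite (gt_eqF y1) orbF => /eqP.
pose g J := enorm (subvec J x) - enorm (subvec J z).
set u := scale_blocks _ _ (y - v).
set r := scale_blocks P g (y - ybar); set w := scale_blocks P g ybar.
have xz : x - z = w + (r + u).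
  apply: (eq_subvec hP) => J JP; rewrite !subvec_linear.
  rewrite !subvec_scale_blocks // !subvec_linear.
  rewrite [in LHS](certificate_block cx JP) [in LHS](certificate_block cz JP) /g.
  by apply/matrixP => i j; rewrite !mxE; ring.
have Vw : Vspace P ybar w.
  apply: Vspace_scale_blocks => // J JH.
  by rewrite /g (inactive x y) // (inactive z v) // subrr.
have e0 : 0 <= e := le_trans (enorm_ge0 _) ye.
have re : enorm r <= e * enorm (x - z).
  rewrite -ler_sqr ?nnegrE ?mulr_ge0 ?enorm_ge0 // exprMn.
  rewrite !(enorm_subvec_sqr _ hP) mulr_sumr; apply: ler_sum => J JP.
  rewrite subvec_scale_blocks // enormZ -exprMn ler_sqr ?nnegrE ?mulr_ge0 ?enorm_ge0 //.
  rewrite mulrC ler_pM ?enorm_ge0 ?(le_trans (enorm_subvec_le _ _) ye) //.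
  rewrite subvecD subvecN /g ler_norml; apply/andP; split.
    have := ler_enormD (subvec J x) (subvec J z - subvec J x).
    by rewrite addrC subrK (enorm_distC (subvec J z)); lra.
  have := ler_enormD (subvec J z) (subvec J x - subvec J z).
  by rewrite addrC subrK; lra.
have le_w : enorm w <= k * (enorm (Phi *m (x - z)) + C * (enorm r + enorm u)).
  apply: le_trans (hk _ Vw) _; rewrite ler_wpM2l //.
  have -> : Phi *m w = Phi *m (x - z) + - (Phi *m (r + u)).
    by rewrite -mulmxBr xz addrK.
  apply: le_trans (ler_enormD _ _) _; rewrite lerD2l enormN.
  by apply: le_trans (hC _) _; rewrite ler_wpM2l // ler_enormD.
have le_xz : enorm (x - z) <= enorm w + (enorm r + enorm u).
  by rewrite [in leLHS]xz (le_trans (ler_enormD _ _)) // lerD2l ler_enormD.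
have kC0 : 0 <= k * C by rewrite mulr_ge0.
have : (1 + k * C) * enorm r <= 2^-1 * enorm (x - z).
  apply: (@le_trans _ _ ((1 + k * C) * (e * enorm (x - z)))).
    by rewrite ler_wpM2l // addr_ge0.
  by rewrite mulrA ler_wpM2r ?enorm_ge0.
lra.
Qed.

(** The error bound of [certificate_error] is squared, both of its terms are
bounded through [dual_vec_monotone] by a multiple of
[enorm (data_shift Phi p q z) * enorm (x - z)], and one factor [enorm (x - z)]
cancels. *)
Lemma Sol_dist_le (R : realType) m n (Phi : 'M[R]_(m, n)) P
    (ybar : 'cV[R]_n) (k C e M mmax : R) p q x z :
  finset.partition P [set: 'I_n]%SET -> 0 <= k -> 0 <= C ->
  (forall w, Vspace P ybar w -> enorm w <= k * enorm (Phi *m w)) ->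
  (forall h, enorm (Phi *m h) <= C * enorm h) ->
  (1 + k * C) * e <= 2^-1 ->
  (forall J, J \in Hset P ybar -> enorm (subvec J ybar) + e < 1) ->
  0 < p.2 -> p.2 <= mmax -> 0 < q.2 -> Sol Phi P p x -> Sol Phi P q z ->
  enorm (dual_vec Phi p.1 p.2 x - ybar) <= e ->
  enorm (dual_vec Phi q.1 q.2 z - ybar) <= e ->
  0 <= M -> norm12 P z <= M ->
  enorm (x - z) <= (8 * k ^+ 2 * mmax + 16 * M * (1 + k * C) ^+ 2) * C
    * enorm (data_shift Phi p q z).
Proof.
case: p q => [b mu] [b' nu] /= hP k0 C0 hk hC kCe He mu0 mum nu0 Sx Sz ye ve M0 zM.
have cx := proj1 (SolP _ _ _ hP mu0) Sx; have cz := proj1 (SolP _ _ _ hP nu0) Sz.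
have err := certificate_error hP k0 C0 hk hC kCe He cx cz ye ve.
have zJM J : J \in P -> enorm (subvec J z) <= M.
  by move=> JP; apply: le_trans (enorm_subvec_le_norm12 _ JP) zM.
have := certificate_curvature hP cx cz zJM.
have := certificate_monotone hP cx cz.
have := dual_vec_monotone Phi (b, mu) (b', nu) x z => /=.
have := dot_le (data_shift Phi (b, mu) (b', nu) z) (Phi *m (x - z)).
move: err (hC (x - z)) (enorm_ge0 (x - z)) (enorm_ge0 (Phi *m (x - z))).
move: (enorm_ge0 (data_shift Phi (b, mu) (b', nu) z)).
set T := enorm (data_shift _ _ _ _); set F := enorm (Phi *m _).
set u := enorm (scale_blocks _ _ _); set E := enorm (x - z).
set D := dot (_ - _) _; set S := dot (data_shift _ _ _ _) _.
have : 0 <= u by apply: enorm_ge0.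
have : 0 <= k * C by rewrite mulr_ge0.
set a := k * C => a0 u0 T0 EFu FE E0 F0 ST DS D0 uD.
have TF : T * F <= C * T * E by rewrite -mulrA mulrCA ler_wpM2l.
have F2 : F ^+ 2 <= mmax * (C * T * E).
  have : mu^-1 * F ^+ 2 <= C * T * E by lra.
  rewrite ler_pdivrMl // => /le_trans; apply.
  by rewrite ler_wpM2r // !mulr_ge0.
have u2 : u ^+ 2 <= 2 * M * (C * T * E).
  apply: le_trans uD _; rewrite ler_wpM2l ?mulr_ge0 //.
  have : 0 <= mu^-1 * F ^+ 2 by rewrite mulr_ge0 ?sqr_ge0 // invr_ge0 ltW.
  lra.
have [E00|E1] := leP E 0.
  apply: le_trans E00 _; apply: mulr_ge0 => //; apply: mulr_ge0 => //.
  have mm0 : 0 <= mmax := le_trans (ltW mu0) mum.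
  apply: addr_ge0; apply: mulr_ge0; rewrite ?sqr_ge0 ?mm0 //.
    by apply: mulr_ge0; rewrite ?sqr_ge0.
  by apply: mulr_ge0.
have E2 : E ^+ 2 <= 8 * k ^+ 2 * F ^+ 2 + 8 * (1 + a) ^+ 2 * u ^+ 2.
  have : E ^+ 2 <= (2 * k * F + 2 * (1 + a) * u) ^+ 2.
    by rewrite ler_sqr ?nnegrE // (le_trans E0).
  have := sqr_ge0 (2 * k * F - 2 * (1 + a) * u); nra.
rewrite -(ler_pM2r E1) -expr2; apply: le_trans E2 _.
apply: (@le_trans _ _ (8 * k ^+ 2 * (mmax * (C * T * E))
    + 8 * (1 + a) ^+ 2 * (2 * M * (C * T * E)))).
  by apply: lerD; rewrite ler_wpM2l // mulr_ge0 ?sqr_ge0.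
by rewrite le_eqVlt; apply/orP; left; apply/eqP; ring.
Qed.

(** The dual vector is the same for all solutions and varies continuously with
the data, even where the solution does not: dropping the nonnegative term
[dot (y - v) (x - z)] from [dual_vec_monotone] bounds
[p.2^-1 * enorm (Phi *m (x - z))] by the norm of the shift. *)
Lemma Sol_dual_vec_le (R : realType) m n (Phi : 'M[R]_(m, n)) P p q x z (C : R) :
  finset.partition P [set: 'I_n]%SET -> 0 <= C ->
  (forall h, enorm (Phi^T *m h) <= C * enorm h) ->
  0 < p.2 -> 0 < q.2 -> Sol Phi P p x -> Sol Phi P q z ->
  enorm (dual_vec Phi p.1 p.2 x - dual_vec Phi q.1 q.2 z)
    <= 2 * C * enorm (data_shift Phi p q z).
Proof.
case: p q => [b mu] [b' nu] /= hP C0 hC mu0 nu0 Sx Sz.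
have cx := proj1 (SolP _ _ _ hP mu0) Sx; have cz := proj1 (SolP _ _ _ hP nu0) Sz.
have D0 := certificate_monotone hP cx cz.
have DS := dual_vec_monotone Phi (b, mu) (b', nu) x z.
have ST := dot_le (data_shift Phi (b, mu) (b', nu) z) (Phi *m (x - z)).
have F0 := enorm_ge0 (Phi *m (x - z)).
have T0 := enorm_ge0 (data_shift Phi (b, mu) (b', nu) z).
rewrite (dual_vecB Phi (b, mu) (b', nu)) /=.
move: DS ST F0 T0 => /=.
set T := enorm (data_shift _ _ _ _); set F := enorm (Phi *m _).
set s := data_shift _ _ _ _; set S := dot s _ => DS ST F0 T0.
have FT : mu^-1 * F <= T.
  have [F00|F1] := leP F 0.
    have -> : F = 0 by apply/eqP; rewrite eq_le F00 F0.
    by rewrite mulr0.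
  by rewrite -(ler_pM2r F1) -mulrA -expr2; lra.
apply: le_trans (hC _) _; rewrite [2 * C]mulrC -mulrA ler_wpM2l //.
apply: le_trans (ler_enormD _ _) _; rewrite enormN enormZ.
by rewrite gtr0_norm ?invr_gt0 // -/T -/F; lra.
Qed.

Lemma edist_continuous (R : realType) m (p0 : 'cV[R]_m * R) :
  continuous (fun p : 'cV[R]_m * R => Defs.edist p p0).
Proof.
have c1 : continuous (fun p : 'cV[R]_m * R => enorm (p.1 - p0.1)).
  apply: enorm_continuous => i; under eq_fun do rewrite !mxE.
  move=> p; apply: cvgB; last exact: cvg_cst.
  apply: (@continuous_comp _ _ _ fst (fun b : 'cV[R]_m => b i 0)).
    exact: cvg_fst.
  exact: coord_continuous.
have c2 : continuous (fun p : 'cV[R]_m * R => p.2 - p0.2).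
  by move=> p; apply: cvgB; [exact: cvg_snd | exact: cvg_cst].
move=> p; apply: (@continuous_comp _ _ _
  (fun p : 'cV[R]_m * R => enorm (p.1 - p0.1) ^+ 2 + (p.2 - p0.2) ^+ 2) Num.sqrt).
  by apply: cvgD; apply: cvgM; (exact: c1 || exact: c2).
exact: sqrt_continuous.
Qed.

Lemma edist_refl (R : realType) m (p : 'cV[R]_m * R) : Defs.edist p p = 0.
Proof. by rewrite /Defs.edist !subrr enorm0 expr0n addr0 sqrtr0. Qed.

Lemma nbhs_edist (R : realType) m (p0 : 'cV[R]_m * R) r :
  0 < r -> nbhs p0 [set p | Defs.edist p p0 < r].
Proof.
move=> r0; apply: (@edist_continuous R m p0 p0 [set t | t < r]).
by rewrite edist_refl; exact: lt_nbhsl.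
Qed.

(** A dual vector within [e] of [y] has the same inactive blocks as [y] at
least, which puts the first term of the decomposition of [x - z] in
[Vspace P y]. *)
Lemma Hset_gap (R : realType) n (P : {set {set 'I_n}}) (y : 'cV[R]_n) :
  exists2 e, 0 < e & forall J, J \in Hset P y -> enorm (subvec J y) + e < 1.
Proof.
pose d := \big[Num.min/1]_(J in Hset P y) (1 - enorm (subvec J y)).
have d0 : 0 < d.
  by apply: lt_bigmin => // J; rewrite inE subr_gt0 => /andP[].
exists (d / 2) => [|J JH]; first by rewrite divr_gt0.
have : d <= 1 - enorm (subvec J y) by apply: bigmin_le_cond.
have : d / 2 < d by rewrite ltr_pdivrMr // ltr_pMr // ltr1n.
lra.
Qed.

(** On a small Euclidean ball around the data, the regularization parameter
stays away from 0 and bounded, solutions are bounded, and dual vectors stay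
within [e] of [ybar]. There [Sol_dist_le] applies to any two solutions, and
taking the same data twice gives uniqueness. *)
Lemma injective_single_valued_lipschitz (R : realType) m n (Phi : 'M[R]_(m, n))
    P p0 x0 :
  finset.partition P [set: 'I_n]%SET -> 0 < p0.2 -> Sol Phi P p0 x0 ->
  Ker Phi `&` Vspace P (dual_vec Phi p0.1 p0.2 x0) = [set 0] ->
  single_valued_lipschitz_around (Sol Phi P) p0 /\ Sol Phi P p0 = [set x0].
Proof.
case: p0 => [b0 mu0] /= hP mu00 Sx0 kerV; set p0 := (b0, mu0) in Sx0 *.
set ybar := dual_vec _ _ _ _ in kerV.
have c0 : certificate P x0 ybar := proj1 (SolP _ _ _ hP mu00) Sx0.
have [k k0 hk] := injective_on_Vspace_bound hP c0 kerV.
have [C C0 hC] := mulmx_enorm_bound Phi.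
have [C' C'0 hC'] := mulmx_enorm_bound Phi^T.
have [e1 e10 gap] := Hset_gap P ybar.
have kC0 : 0 < 1 + k * C by rewrite ltr_pwDl // mulr_ge0.
(* Small enough to keep the inactive blocks and to absorb half of [x - z] in
   [certificate_error]. *)
pose e := Num.min e1 (2^-1 / (1 + k * C)).
have e0 : 0 < e by rewrite lt_min e10 divr_gt0 // invr_gt0.
have kCe : (1 + k * C) * e <= 2^-1 by rewrite mulrC -ler_pdivlMr // ge_min lexx orbT.
have He J : J \in Hset P ybar -> enorm (subvec J ybar) + e < 1.
  move=> JH; apply: le_lt_trans (gap _ JH).
  by rewrite lerD2l ge_min lexx.
pose m0 := mu0 / 2; have m00 : 0 < m0 by rewrite divr_gt0.
pose B := enorm b0 + m0; have B0 : 0 <= B by rewrite addr_ge0 ?enorm_ge0 // ltW.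
pose L1 := m0^-1 + m0^-1 * m0^-1 * B.
have L10 : 0 <= L1 by rewrite addr_ge0 ?mulr_ge0 // ?invr_ge0 ltW.
pose M := (2 * m0)^-1 * B ^+ 2.
have M0 : 0 <= M by rewrite mulr_ge0 ?sqr_ge0 // invr_ge0 mulr_ge0 // ltW.
pose K := 2 * C' * L1; have K0 : 0 <= K by rewrite !mulr_ge0.
(* [K] is the Lipschitz constant of the dual vector at [p0]; the [+ 1] only
   avoids a division by zero. *)
pose r := Num.min m0 (e / (K + 1)).
have K1 : 0 < K + 1 by rewrite ltr_wpDl.
have r0 : 0 < r by rewrite lt_min m00 divr_gt0.
pose U := [set p : 'cV[R]_m * R | Defs.edist p p0 < r].
have nU : nbhs p0 U by apply: nbhs_edist.
have Up0 : U p0 by rewrite /U /= edist_refl.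
have Umu p : U p -> m0 <= p.2 /\ p.2 <= 2 * mu0.
  move=> Up; have : `|p.2 - mu0| <= m0.
    apply: le_trans (edist_snd_le p p0) _; apply/ltW/(lt_le_trans Up).
    by rewrite ge_min lexx.
  have : m0 + m0 = mu0 by rewrite /m0; field.
  by rewrite ler_norml => ? /andP[? ?]; split; lra.
have Ugt0 p : U p -> 0 < p.2 by move=> /Umu[/(lt_le_trans m00)].
have Ub p : U p -> enorm p.1 <= B.
  move=> Up; rewrite -(subrK b0 p.1) (le_trans (ler_enormD _ _)) // addrC lerD2l.
  apply: le_trans (edist_fst_le p p0) _; apply/ltW/(lt_le_trans Up).
  by rewrite ge_min lexx.
have shift p q z : U p -> U q -> Sol Phi P q z ->
    enorm (data_shift Phi p q z) <= L1 * Defs.edist p q.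
  move=> Up Uq Sz; have [pm _] := Umu _ Up; have [qm _] := Umu _ Uq.
  apply: data_shift_le => //; apply: le_trans (Ub _ Uq).
  by apply: (@Sol_residual_le _ _ _ _ P _ q.2); [exact: Ugt0 | case: q Sz {Uq qm}].
have Uy p x : U p -> Sol Phi P p x -> enorm (dual_vec Phi p.1 p.2 x - ybar) <= e.
  move=> Up Sx.
  apply: le_trans (Sol_dual_vec_le (q := p0) hP C'0 hC' (Ugt0 _ Up) mu00 Sx Sx0) _.
  apply: (@le_trans _ _ (K * Defs.edist p p0)).
    by rewrite /K -[leRHS]mulrA ler_wpM2l ?mulr_ge0 // shift.
  apply: (@le_trans _ _ ((K + 1) * r)).
    by apply: ler_pM => //; [exact: sqrtr_ge0 | rewrite lerDl | exact: ltW].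
  by rewrite mulrC -ler_pdivlMr // ge_min lexx orbT.
have UM q z : U q -> Sol Phi P q z -> norm12 P z <= M.
  case: q => b nu Uq Sz; have [/= qm _] := Umu _ Uq; have /= nu0 := Ugt0 _ Uq.
  apply: le_trans (Sol_norm12_le nu0 Sz) _.
  have n2 : 0 < 2 * nu by rewrite mulr_gt0.
  have m2 : 0 < 2 * m0 by rewrite mulr_gt0.
  rewrite ler_pM ?sqr_ge0 ?invr_ge0 ?(ltW n2) //.
    by rewrite lef_pV2 ?posrE // ler_wpM2l.
  by rewrite ler_sqr ?nnegrE ?enorm_ge0 //; exact: Ub Uq.
pose L := (8 * k ^+ 2 * (2 * mu0) + 16 * M * (1 + k * C) ^+ 2) * C.
have L0 : 0 <= L.
  apply: mulr_ge0 => //; apply: addr_ge0; apply: mulr_ge0; rewrite ?sqr_ge0 //.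
  - by rewrite mulr_ge0 ?sqr_ge0.
  - by rewrite mulr_ge0 // ltW.
  - by rewrite mulr_ge0.
have lip p q x z : U p -> U q -> Sol Phi P p x -> Sol Phi P q z ->
    enorm (x - z) <= L * L1 * Defs.edist p q.
  move=> Up Uq Sx Sz; have [_ pm] := Umu _ Up.
  apply: le_trans (Sol_dist_le hP k0 C0 hk hC kCe He (Ugt0 _ Up) pm (Ugt0 _ Uq)
    Sx Sz (Uy _ _ Up Sx) (Uy _ _ Uq Sz) M0 (UM _ _ Uq Sz)) _.
  by rewrite -[leRHS]mulrA; apply: ler_wpM2l; [exact: L0 | exact: shift].
have uniq p x z : U p -> Sol Phi P p x -> Sol Phi P p z -> x = z.
  move=> Up Sx Sz; apply/eqP; rewrite -subr_eq0; apply/eqP/enorm_eq0.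
  by apply: le_trans (lip p p _ _ Up Up Sx Sz) _; rewrite edist_refl mulr0.
have sv p x : U p -> Sol Phi P p x -> Sol Phi P p = [set x].
  move=> Up Sx; apply/seteqP; split=> [z Sz|z ->] //.
  exact: (uniq _ _ _ Up Sz Sx).
split; last exact: sv.
pose s p := xget 0 (Sol Phi P p).
have sP p : U p -> Sol Phi P p (s p).
  case: p => b mu Up; have [x Sx] := Sol_exists Phi b hP (Ugt0 _ Up).
  by rewrite /s; apply: (xgetPex 0); exists x.
exists U, s, (L * L1); split=> // [p Up|p q Up Uq].
  by apply: sv => //; apply: sP.
by apply: lip => //; apply: sP.
Qed.

(** * The equivalence *)

Theorem theorem3p13 (R : realType) (m n : nat) (Phi : 'M[R]_(m, n))
    (P : {set {set 'I_n}}) (hP : finset.partition P [set: 'I_n]%SET)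
    (bbar : 'cV[R]_m) (mubar : R) (hmu : 0 < mubar)
    (xbar : 'cV[R]_n) (hx : Sol Phi P (bbar, mubar) xbar) :
  let ybar := dual_vec Phi bbar mubar xbar in
  [<-> Ker Phi `&` Vspace P ybar = [set 0];
       single_valued_lipschitz_around (Sol Phi P) (bbar, mubar)
         /\ Sol Phi P (bbar, mubar) = [set xbar];
       single_valued_around (Sol Phi P) (bbar, mubar)
         /\ Sol Phi P (bbar, mubar) = [set xbar]].
Proof.
move=> ybar; tfae.
- exact: (injective_single_valued_lipschitz (p0 := (bbar, mubar)) hP hmu hx).
- case=> -[U [s [L [nU Umu sU _]]]] Sx; split; last exact: Sx.
  by exists U; split=> [||p Up]; [exact: nU | exact: Umu | exists (s p); apply: sU].
- by case=> sv _; exact: (single_valued_around_injective hP hx sv).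
Qed.
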